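(* Let $(X,D)$ be an $\mathcal{F}$-metric space with $(f,\alpha)\in\mathcal{F}\times[0,\infty)$, and let $d$ be the metric on $X$ defined by $$d(x,y)=\inf\left\{\sum_{i=1}^{N-1}D(u_i,u_{i+1}) : N\in\mathbb{N},\ N\ge 2,\ \{u_i\}_{i=1}^{N}\subseteq X \text{ with } (u_1,u_N)=(x,y)\right\}.$$ Then a subset $A\subseteq X$ is $\mathcal{F}$-totally bounded if and only if $A$ is totally bounded with respect to the metric $d$.
   Context: $\mathcal{F}$ denotes the class of functions $f:(0,\infty)\to\mathbb{R}$ such that: ($\mathcal{F}_1$) $f$ is non-decreasing, i.e. $0<s<t$ implies $f(s)\le f(t)$; ($\mathcal{F}_2$) for every sequence $\{t_n\}_{n\in\mathbb{N}}\subseteq(0,\infty)$, $\lim_{n\to\infty}t_n=0$ if and only if $\lim_{n\to\infty}f(t_n)=-\infty$. Let $X$ be a non-empty set and $D:X\times X\to[0,\infty)$ a mapping. $(X,D)$ is an $\mathcal{F}$-metric space with $(f,\alpha)\in\mathcal{F}\times[0,\infty)$ if: (D1) for all $x,y\in X$, $D(x,y)=0$ if and only if $x=y$; (D2) $D(x,y)=D(y,x)$ for all $x,y\in X$; (D3) for every $(x,y)\in X\times X$, every $N\in\mathbb{N}$ with $N\ge 2$, and every $(u_i)_{i=1}^{N}\subseteq X$ with $(u_1,u_N)=(x,y)$, if $D(x,y)>0$ then $f(D(x,y))\le f\left(\sum_{i=1}^{N-1}D(u_i,u_{i+1})\right)+\alpha$. It is known that the function $d$ in the claim is then a metric on $X$.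 For $x\in X$, $r>0$ let $B_D(x,r)=\{y\in X: D(x,y)<r\}$ and $B_d(x,r)=\{y\in X: d(x,y)<r\}$. A subset $A\subseteq X$ is $\mathcal{F}$-totally bounded if for every $\varepsilon>0$ there is a finite set $\{a_1,\dots,a_n\}\subseteq A$ with $A\subseteq\bigcup_{i=1}^{n}B_D(a_i,\varepsilon)$. Likewise, $A$ is totally bounded with respect to $d$ if for every $\varepsilon>0$ there is a finite set $\{a_1,\dots,a_n\}\subseteq A$ with $A\subseteq\bigcup_{i=1}^{n}B_d(a_i,\varepsilon)$. *)

(* Defs.v *)
From HB Require Import structures.
From mathcomp Require Import all_boot all_order all_algebra.
From mathcomp Require Import all_classical all_reals all_analysis.

Set Implicit Arguments.
Unset Strict Implicit.
Unset Printing Implicit Defensive.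

Import Order.TTheory GRing.Theory Num.Theory.
Import numFieldNormedType.Exports.

Local Open Scope classical_set_scope.
Local Open Scope ring_scope.

(* Functions on (0, +oo) are encoded as functions on R of which only the values
   at positive arguments are constrained. *)
Record classF (R : realType) (f : R -> R) : Prop := ClassF {
  classF_ndecr : forall s t : R, 0 < s -> s < t -> f s <= f t;
  classF_lim : forall t : nat -> R, (forall n, 0 < t n) ->
    (t n @[n --> \oo] --> (0 : R)) <-> (f (t n) @[n --> \oo] --> -oo)
}.

(* A chain u_1, ..., u_N is encoded as u : nat -> X, of which only the values
   at 1, ..., N are used. *)
Definition chain (X : Type) (x y : X) (N : nat) (u : nat -> X) : Prop :=
  [/\ (2 <= N)%N, u 1%N = x & u N = y].

Definition chain_length (R : realType) (X : Type) (D : X -> X -> R)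
    (N : nat) (u : nat -> X) : R :=
  \sum_(1 <= i < N) D (u i) (u i.+1).

(* In Fmetric_chain the chain length is positive whenever D x y is, by
   Fmetric_ge0 and Fmetric_eq0, so f is only evaluated on its domain. *)
Record Fmetric_space (R : realType) (X : Type) (D : X -> X -> R)
    (f : R -> R) (alpha : R) : Prop := FmetricSpace {
  Fmetric_nonempty : inhabited X;
  Fmetric_ge0 : forall x y, 0 <= D x y;
  Fmetric_classF : classF f;
  Fmetric_alpha_ge0 : 0 <= alpha;
  Fmetric_eq0 : forall x y, D x y = 0 <-> x = y;
  Fmetric_sym : forall x y, D x y = D y x;
  Fmetric_chain : forall (x y : X) (N : nat) (u : nat -> X), chain x y N u ->
    0 < D x y -> f (D x y) <= f (chain_length D N u) + alpha
}.

Definition chain_dist (R : realType) (X : Type) (D : X -> X -> R) (x y : X) : R :=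
  inf [set s : R | exists (N : nat) (u : nat -> X),
    chain x y N u /\ s = chain_length D N u].

Definition dist_ball (R : realType) (X : Type) (rho : X -> X -> R)
    (x : X) (r : R) : set X := [set y | rho x y < r].

(* With rho := D this is F-total boundedness; with rho := chain_dist D it is
   total boundedness for the induced metric.  F may be empty (when A is). *)
Definition totally_bounded (R : realType) (X : Type) (rho : X -> X -> R)
    (A : set X) : Prop :=
  forall eps : R, 0 < eps -> exists F : set X,
    [/\ finite_set F, F `<=` A & A `<=` \bigcup_(a in F) dist_ball rho a eps].

(* Main.v *)
Require Import Defs.
From mathcomp Require Import all_boot all_order all_algebra.
From mathcomp Require Import all_classical all_reals all_analysis.

(** Since a two-point chain is allowed, [d <= D], so [D]-balls lie in [d]-balls.
    Conversely, if [d x y] is small there is a chain of small length [s] from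
    [x] to [y], and (D3) gives [f (D x y) <= f s + alpha]; as [f] tends to
    [-oo] at [0+] and is non-decreasing, this forces [D x y] to be small. *)

Set Implicit Arguments.
Unset Strict Implicit.
Unset Printing Implicit Defensive.

Import Order.TTheory GRing.Theory Num.Theory.
Import numFieldNormedType.Exports.

Local Open Scope classical_set_scope.
Local Open Scope ring_scope.

(** Along the sequence [1/(n+1)], which tends to 0, [f] tends to [-oo], so some term has its value
    below [M]; monotonicity extends the bound to all smaller arguments. *)
Lemma classF_small (R : realType) (f : R -> R) (M : R) : classF f ->
  exists2 delta : R, 0 < delta & forall s, 0 < s -> s < delta -> f s < M.
Proof.
move=> [fnd flim].
have [+ _] := flim (@harmonic R) (fun n => harmonic_gt0 n).
move=> /(_ (@cvg_harmonic R)) /cvgrNy_lt /(_ M) [n _ fM].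
exists (harmonic n); first exact: harmonic_gt0.
by move=> s s0 /(fnd _ _ s0) /le_lt_trans; apply; apply: fM => /=.
Qed.

(** The same finite set of centres serves both covers, since [delta] does not depend on the
    centre. *)
Lemma totally_bounded_sub_ball (R : realType) (X : Type)
    (rho1 rho2 : X -> X -> R) (A : set X) :
  (forall eps, 0 < eps -> exists2 delta, 0 < delta &
    forall x, dist_ball rho1 x delta `<=` dist_ball rho2 x eps) ->
  totally_bounded rho1 A -> totally_bounded rho2 A.
Proof.
move=> sub12 tb1 eps /sub12[delta delta0 sub]; have [F [Ffin FA AF]] := tb1 _ delta0.
exists F; split => //; apply: (subset_trans AF).
by apply: subset_bigcup => a _; apply: sub.
Qed.

Section Fmetric.
Variables (R : realType) (X : Type) (D : X -> X -> R) (f : R -> R) (alpha : R).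
Hypothesis hD : Fmetric_space D f alpha.

Lemma chain_length_ge0 N u : 0 <= chain_length D N u.
Proof. by apply: sumr_ge0 => i _; apply: (Fmetric_ge0 hD). Qed.

Lemma chain_length_eq0 x y N u :
  chain x y N u -> chain_length D N u = 0 -> x = y.
Proof.
(* With the endpoints replaced by [u 1] and [u N], induction on [N] starts at 2; a vanishing sum of
   nonnegative terms makes consecutive points coincide. *)
case=> N2 <- <- {x y}; elim: N N2 => // -[//|[_ _|N IH _]].
  by rewrite /chain_length big_nat1 => /(Fmetric_eq0 hD).
rewrite /chain_length big_nat_recr//= => /eqP.
rewrite paddr_eq0 ?chain_length_ge0 ?(Fmetric_ge0 hD)//.
by move=> /andP[/eqP /(IH isT) -> /eqP /(Fmetric_eq0 hD)].
Qed.

(** Ensures that (D3) evaluates [f] at a positive length, where the bound of [classF_small]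
    applies. *)
Lemma chain_length_gt0 x y N u :
  chain x y N u -> 0 < D x y -> 0 < chain_length D N u.
Proof.
move=> c Dxy; rewrite lt0r chain_length_ge0 andbT; apply/eqP.
move=> /(chain_length_eq0 c) /(Fmetric_eq0 hD) Dxy0.
by rewrite Dxy0 ltxx in Dxy.
Qed.

Lemma chain_lengths_direct x y : [set s : R | exists (N : nat) (u : nat -> X),
  chain x y N u /\ s = chain_length D N u] (D x y).
Proof.
exists 2%N, (fun i => if i == 1%N then x else y); split => //.
by rewrite /chain_length big_nat1.
Qed.

Lemma chain_dist_le x y : chain_dist D x y <= D x y.
Proof.
apply: ge_inf (chain_lengths_direct x y).
by exists 0 => _ [N [u [_ ->]]]; exact: chain_length_ge0.
Qed.

Lemma chain_dist_lt x y r : chain_dist D x y < r ->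
  exists N u, chain x y N u /\ chain_length D N u < r.
Proof.
move=> /inf_lt[|_ [N [u [c ->]]] lt_r]; last by exists N, u.
(* Nonemptiness matters here: the [inf] of the empty set is 0 by convention. *)
by exists (D x y); exact: chain_lengths_direct.
Qed.

Lemma dist_ball_chain_dist_sub eps : 0 < eps -> exists2 delta, 0 < delta &
  forall x, dist_ball (chain_dist D) x delta `<=` dist_ball D x eps.
Proof.
move=> eps0.
(* If [eps <= D x y], then (D3) gives [f eps - alpha <= f s] for the length [s] of any chain from
   [x] to [y]; this threshold excludes all [s < delta]. *)
have [delta delta0 fdelta] := classF_small (f eps - alpha) (Fmetric_classF hD).
exists delta => // x y /chain_dist_lt[N [u [c lt_delta]]].
rewrite /dist_ball /= ltNge; apply/negP => le_eps.
have Dxy := lt_le_trans eps0 le_eps.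
have fs := fdelta _ (chain_length_gt0 c Dxy) lt_delta.
have : f eps <= f (D x y).
  move: le_eps; rewrite le_eqVlt => /orP[/eqP -> //|].
  exact: (classF_ndecr (Fmetric_classF hD)).
move=> /le_trans /(_ (Fmetric_chain hD c Dxy)).
by rewrite -lerBlDr leNgt fs.
Qed.

End Fmetric.

Theorem theorem2p6 (R : realType) (X : Type) (D : X -> X -> R)
    (f : R -> R) (alpha : R) (hD : Fmetric_space D f alpha) (A : set X) :
  totally_bounded D A <-> totally_bounded (chain_dist D) A.
Proof.
split; apply: totally_bounded_sub_ball => eps eps0.
  by exists eps => // x y; apply: le_lt_trans; exact: (chain_dist_le hD).
exact: (dist_ball_chain_dist_sub hD).
Qed.
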